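(* Let $\gamma_1,\gamma_2$ be constants, each real or purely imaginary. On $T^*\mathbb{R}^2$ with canonical coordinates $(q_1,q_2,p_1,p_2)$ let $$H_{(2)}=p_1^2+p_2^2+\gamma_1(q_1p_1+q_2p_2)+\gamma_2(q_1p_1+q_2p_2)^2,\qquad I_2=\bigl(1+\gamma_2(q_1^2+q_2^2)\bigr)p_2^2+\gamma_1q_2p_2,$$ and $$K_{I_2}=\begin{pmatrix}0&0&0&0\\-\gamma_2q_1q_2&1+\gamma_2q_1^2&0&0\\0&-\gamma_2q_1p_2&0&-\gamma_2q_1q_2\\\gamma_2q_1p_2&0&0&1+\gamma_2q_1^2\end{pmatrix}.$$ 1. $K_{I_2}$ is a Haantjes operator compatible with $\omega=dq_1\wedge dp_1+dq_2\wedge dp_2$ and satisfies the chain equation $K_{I_2}^T\,dH_{(2)}=dI_2$. Its eigenvalues are $0$ and $1+\gamma_2q_1^2$, each of multiplicity two, and it is semisimple. The operator $\mathcal N_{I_2}=K_{I_2}-\tfrac12\operatorname{tr}(K_{I_2})\,I$ is a Nijenhuis operator, with eigenvalues $-(1+\gamma_2q_1^2)$ and $0$. 2. Darboux--Haantjes coordinates for the pair $(H_{(2)},I_2)$ are given by the extended point transformation $$Q_1=q_1,\quad P_1=p_1+\frac{\gamma_2q_1q_2p_2}{1+\gamma_2q_1^2},\quad Q_2=\frac{q_2}{\sqrt{1+\gamma_2q_1^2}},\quad P_2=p_2\sqrt{1+\gamma_2q_1^2},$$ which is canonical and reduces to the identity in the limit $\gamma_2\to0$. 3. In these coordinates $$I_2=P_2^2+\gamma_1Q_2P_2+\gamma_2(Q_2P_2)^2,$$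 $$H_{(2)}=P_1^2+\gamma_1Q_1P_1+\gamma_2(Q_1P_1)^2+\frac{P_2^2+\gamma_1Q_2P_2+\gamma_2(Q_2P_2)^2}{1+\gamma_2Q_1^2}.$$
   Context: Matrices of operators are written with respect to the frame $\partial_{q_1},\partial_{q_2},\partial_{p_1},\partial_{p_2}$. For a $(1,1)$ tensor field $L$, the Nijenhuis torsion is $T_L(X,Y)=L^2[X,Y]+[LX,LY]-L([X,LY]+[LX,Y])$ and the Haantjes torsion is $\mathcal H_L(X,Y)=L^2T_L(X,Y)+T_L(LX,LY)-L(T_L(X,LY)+T_L(LX,Y))$. $L$ is a Nijenhuis (respectively Haantjes) operator if $T_L\equiv0$ (respectively $\mathcal H_L\equiv0$). Compatibility with $\omega$: $\Omega K=K^T\Omega$, where $\omega(X,Y)=\langle\Omega X,Y\rangle$. Semisimple: algebraic and geometric multiplicity coincide for every eigenvalue. Darboux--Haantjes coordinates: coordinates in which $\omega=\sum_i dQ_i\wedge dP_i$ and the Haantjes operator is diagonal; they are separation variables for the Hamilton--Jacobi equation. Extended point transformation: a canonical transformation whose new positions depend only on the old positions. Canonical: $\{Q_i,Q_j\}=\{P_i,P_j\}=0$, $\{Q_i,P_j\}=\delta_{ij}$.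
   Formalization: Multiplicity two, semisimplicity, and the claims on the transformation and on H, I in new coordinates (except the limit γ₂→0) are asserted only where 1+γ₂q₁²≠0; on its zero set (real γ₂<0) the eigenvalues merge, K is in general not semisimple, and P₁, Q₂ are undefined. *)

(* Defs.v *)
From HB Require Import structures.
From mathcomp Require Import all_boot all_order all_algebra.
From mathcomp Require Import complex.
From mathcomp Require Import all_classical all_reals.
From mathcomp Require Import topology normedtype derive.

Set Implicit Arguments.
Unset Strict Implicit.
Unset Printing Implicit Defensive.

Import Order.TTheory GRing.Theory Num.Theory.
Import numFieldNormedType.Exports.

Local Open Scope ring_scope.
Local Open Scope classical_set_scope.
Local Open Scope complex_scope.

(* A point of T^*R^2 is a real row vector (q_1, q_2, p_1, p_2).  Since the
   parameters may be imaginary, functions, vector fields and operators on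
   T^*R^2 take complex values.  A tangent vector is a column of components in
   the frame d/dq_1, d/dq_2, d/dp_1, d/dp_2, and operators act on columns. *)

Section Calculus.
Variable R : realType.
Local Notation C := R[i].
Local Notation pt := 'rV[R]_4.

Definition qix (i : 'I_2) : 'I_4 := lshift 2 i.
Definition pix (i : 'I_2) : 'I_4 := rshift 2 i.

Definition repart (f : pt -> C) (x : pt) : R := complex.Re (f x).
Definition impart (f : pt -> C) (x : pt) : R := complex.Im (f x).

Definition pderiv (i : 'I_4) (f : pt -> C) (x : pt) : C :=
  ('D_('e_i) (repart f) x) +i* ('D_('e_i) (impart f) x).

Fixpoint Ck (k : nat) (U : set pt) (f : pt -> C) : Prop :=
  (forall x, U x -> {for x, continuous (repart f)} /\
                    {for x, continuous (impart f)}) /\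
  (if k is k'.+1 then
     forall i, (forall x, U x -> derivable (repart f) x 'e_i /\
                                 derivable (impart f) x 'e_i)
               /\ Ck k' U (pderiv i f)
   else True).

Definition smooth_on (U : set pt) (f : pt -> C) : Prop := forall k, Ck k U f.

Definition vfield := pt -> 'cV[C]_4.
Definition opfield := pt -> 'M[C]_4.

Definition smooth_vfield (X : vfield) : Prop :=
  forall i, smooth_on setT (fun x => X x i 0).

Definition smooth_opfield (L : opfield) : Prop :=
  forall i j, smooth_on setT (fun x => L x i j).

Definition op_app (L : opfield) (X : vfield) : vfield := fun x => L x *m X x.

Definition lie_bracket (X Y : vfield) : vfield := fun x =>
  \col_i \sum_j (X x j 0 * pderiv j (fun y => Y y i 0) x
                 - Y x j 0 * pderiv j (fun y => X y i 0) x).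

Definition nijenhuis_torsion (L : opfield) (X Y : vfield) : vfield := fun x =>
  op_app L (op_app L (lie_bracket X Y)) x + lie_bracket (op_app L X) (op_app L Y) x
  - op_app L (fun y => lie_bracket X (op_app L Y) y + lie_bracket (op_app L X) Y y) x.

Definition haantjes_torsion (L : opfield) (X Y : vfield) : vfield := fun x =>
  op_app L (op_app L (nijenhuis_torsion L X Y)) x
  + nijenhuis_torsion L (op_app L X) (op_app L Y) x
  - op_app L (fun y => nijenhuis_torsion L X (op_app L Y) y
                    + nijenhuis_torsion L (op_app L X) Y y) x.

Definition nijenhuis_operator (L : opfield) : Prop :=
  smooth_opfield L /\
  forall X Y, smooth_vfield X -> smooth_vfield Y ->
    forall x, nijenhuis_torsion L X Y x = 0.

Definition haantjes_operator (L : opfield) : Prop :=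
  smooth_opfield L /\
  forall X Y, smooth_vfield X -> smooth_vfield Y ->
    forall x, haantjes_torsion L X Y x = 0.

Definition dfun (f : pt -> C) (x : pt) : 'cV[C]_4 :=
  \col_i pderiv i f x.

(* The form dq_1 /\ dp_1 + dq_2 /\ dp_2. *)
Definition omega (X Y : 'cV[C]_4) : C :=
  \sum_(i < 2) (X (qix i) 0 * Y (pix i) 0 - X (pix i) 0 * Y (qix i) 0).

(* omega X Y = <Omega X, Y>, hence Omega_{ij} = omega (e_j, e_i). *)
Definition Omega : 'M[C]_4 :=
  \matrix_(i, j) omega (delta_mx j 0) (delta_mx i 0).

Definition omega_compatible (K : opfield) : Prop :=
  forall x, Omega *m K x = (K x)^T *m Omega.

Definition poisson (f g : pt -> C) (x : pt) : C :=
  \sum_(i < 2) (pderiv (qix i) f x * pderiv (pix i) g x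
                - pderiv (pix i) f x * pderiv (qix i) g x).

(* [eigenvalue] and [eigenspace] refer to row vectors; transposing the matrix
   turns them into the notions for the operator acting on columns. *)
Definition op_eigenvalue (A : 'M[C]_4) (a : C) : bool := eigenvalue A^T a.
Definition alg_mult (A : 'M[C]_4) (a : C) : nat := mup a (char_poly A).
Definition geom_mult (A : 'M[C]_4) (a : C) : nat := \rank (eigenspace A^T a).

Definition semisimple (A : 'M[C]_4) : Prop :=
  forall a, op_eigenvalue A a -> alg_mult A a = geom_mult A a.

(* Transformations Phi = (Q_1, Q_2, P_1, P_2) on an open set U. *)
Definition trans := pt -> 'rV[C]_4.

Definition component (Phi : trans) (i : 'I_4) : pt -> C := fun x => Phi x 0 i.

Definition jacobian (Phi : trans) (x : pt) : 'M[C]_4 :=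
  \matrix_(i, j) pderiv j (component Phi i) x.

Definition coordinate_system (U : set pt) (Phi : trans) : Prop :=
  [/\ open U,
      forall i, smooth_on U (component Phi i),
      {in U &, injective Phi} &
      forall x, U x -> jacobian Phi x \in unitmx].

Definition canonical_trans (U : set pt) (Phi : trans) : Prop :=
  forall x, U x -> forall i j : 'I_2,
    [/\ poisson (component Phi (qix i)) (component Phi (qix j)) x = 0,
        poisson (component Phi (pix i)) (component Phi (pix j)) x = 0 &
        poisson (component Phi (qix i)) (component Phi (pix j)) x = (i == j)%:R].

Definition extended_point_transformation (U : set pt) (Phi : trans) : Prop :=
  canonical_trans U Phi /\
  forall x y, U x -> U y -> (forall i, x 0 (qix i) = y 0 (qix i)) ->
    forall i, component Phi (qix i) x = component Phi (qix i) y.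

(* The third condition is omega = dQ_1 /\ dP_1 + dQ_2 /\ dP_2: the new
   components of X are jacobian Phi x *m X.  The matrix in the fourth one
   represents K in the new coordinate frame. *)
Definition darboux_haantjes (U : set pt) (K : opfield) (Phi : trans) : Prop :=
  [/\ haantjes_operator K,
      coordinate_system U Phi,
      forall x, U x -> forall X Y,
        omega (jacobian Phi x *m X) (jacobian Phi x *m Y) = omega X Y &
      forall x, U x ->
        is_diag_mx (jacobian Phi x *m K x *m invmx (jacobian Phi x))].

(* The joint level sets H = h1, I = h2 are described by separation relations,
   each involving a single conjugate pair (Q_k, P_k).  With P_k = W_k'(Q_k) the
   Hamilton-Jacobi equations for W = W_1(Q_1) + W_2(Q_2) thus decouple into one
   ordinary dfun equation for each W_k. *)
Definition separation_variables (U : set pt) (H I : pt -> C) (Phi : trans) :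
    Prop :=
  exists phi : 'I_2 -> C -> C -> C -> C -> C,
    forall x, U x -> forall h1 h2 : C,
      (H x = h1 /\ I x = h2) <->
      (forall k, phi k (component Phi (qix k) x) (component Phi (pix k) x) h1 h2 = 0).

Definition real_or_imaginary (g : C) : Prop :=
  complex.Im g = 0 \/ complex.Re g = 0.

End Calculus.

Section Model.
Variable R : realType.
Local Notation C := R[i].
Local Notation pt := 'rV[R]_4.

Definition q1 (x : pt) : C := (x 0 0)%:C.
Definition q2 (x : pt) : C := (x 0 1)%:C.
Definition p1 (x : pt) : C := (x 0 2)%:C.
Definition p2 (x : pt) : C := (x 0 3)%:C.

Definition H2 (g1 g2 : C) (x : pt) : C :=
  p1 x ^+ 2 + p2 x ^+ 2 + g1 * (q1 x * p1 x + q2 x * p2 x)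
  + g2 * (q1 x * p1 x + q2 x * p2 x) ^+ 2.

Definition I2 (g1 g2 : C) (x : pt) : C :=
  (1 + g2 * (q1 x ^+ 2 + q2 x ^+ 2)) * p2 x ^+ 2 + g1 * q2 x * p2 x.

Definition mx4 (s : seq (seq C)) : 'M[C]_4 :=
  \matrix_(i, j) nth 0 (nth [::] s i) j.

Definition K_I2 (g2 : C) : opfield R := fun x => mx4
  [:: [:: 0; 0; 0; 0];
      [:: - g2 * q1 x * q2 x; 1 + g2 * q1 x ^+ 2; 0; 0];
      [:: 0; - g2 * q1 x * p2 x; 0; - g2 * q1 x * q2 x];
      [:: g2 * q1 x * p2 x; 0; 0; 1 + g2 * q1 x ^+ 2]].

Definition N_I2 (g2 : C) : opfield R := fun x =>
  K_I2 g2 x - (2^-1 * \tr (K_I2 g2 x))%:M.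

(* Where 1 + g2 q_1^2 vanishes, K_I2 is nilpotent (and nonzero in general) and
   the transformation below is singular. *)
Definition regular_domain (g2 : C) : set pt :=
  [set x | 1 + g2 * q1 x ^+ 2 != 0].

(* [sqrtc] is the principal square root: it is the usual real root where
   1 + g2 q_1^2 is a nonnegative real. *)
Definition Q1 (x : pt) : C := q1 x.
Definition P1 (g2 : C) (x : pt) : C :=
  p1 x + g2 * q1 x * q2 x * p2 x / (1 + g2 * q1 x ^+ 2).
Definition Q2 (g2 : C) (x : pt) : C := q2 x / sqrtc (1 + g2 * q1 x ^+ 2).
Definition P2 (g2 : C) (x : pt) : C := p2 x * sqrtc (1 + g2 * q1 x ^+ 2).

Definition QP (g2 : C) : trans R := fun x =>
  \row_j nth 0 [:: Q1 x; Q2 g2 x; P1 g2 x; P2 g2 x] j.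

End Model.

(* Main.v *)
Require Import Defs.
From HB Require Import structures.
From mathcomp Require Import all_boot all_order all_algebra.
From mathcomp Require Import complex.
From mathcomp Require Import all_classical all_reals.
From mathcomp Require Import topology normedtype derive.
From mathcomp Require Import realfun ring lra.

(* The torsion of [L] at a point is (D_(LX) L) Y - (D_(LY) L) X
   - L ((D_X L) Y - (D_Y L) X), with D_V L the entrywise directional derivative:
   it involves only the values of X and Y there, so both torsion conditions
   become polynomial identities in the components of X and Y.
   Put a = 1 + g2 q_1^2 and S = sqrt a.  The Jacobian J of the transformation is
   rational in q, p and S and satisfies J K = diag (0, a, 0, a) J, which gives the
   diagonal form.  The only analytic point is the smoothness of S: for real g2,
   a is real and S is locally sqrt a or i sqrt (- a); for imaginary g2, Re a = 1
   and a stays off the branch cut.  Since |sqrt z - 1| <= |z - 1|, the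
   transformation tends to the identity. *)

Set Implicit Arguments.
Unset Strict Implicit.
Unset Printing Implicit Defensive.

Import Order.TTheory GRing.Theory Num.Theory.
Import numFieldNormedType.Exports.

Local Open Scope ring_scope.
Local Open Scope classical_set_scope.
Local Open Scope complex_scope.

(** * Partial derivatives of complex-valued functions of real coordinates *)

Section ComplexCalculus.
Variable R : realType.
Local Notation C := R[i].
Local Notation pt := 'rV[R]_4.
Implicit Types (f g : pt -> C) (x : pt) (i : 'I_4) (c d : C) (U : set pt).

(** [pderiv] is total and returns a value even where no derivative exists. The relation carries
    existence together with the value, so the rules below compose without separate derivability
    goals. *)
Definition is_pderiv i f x c : Prop :=
  is_derive x 'e_i (repart f) (complex.Re c) /\
  is_derive x 'e_i (impart f) (complex.Im c).

Lemma is_pderiv_val i f x c : is_pderiv i f x c -> pderiv i f x = c.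
Proof. by case: c => a b [h1 h2]; rewrite /pderiv !derive_val. Qed.

Lemma is_pderiv_eq i f x c d : is_pderiv i f x c -> c = d -> is_pderiv i f x d.
Proof. by move=> h <-. Qed.

Lemma is_pderivP i f x :
  derivable (repart f) x 'e_i /\ derivable (impart f) x 'e_i ->
  is_pderiv i f x (pderiv i f x).
Proof. by case=> h1 h2; split; apply: derivableP. Qed.

Lemma is_pderiv_derivable i f x c : is_pderiv i f x c ->
  derivable (repart f) x 'e_i /\ derivable (impart f) x 'e_i.
Proof. by case=> [[h1 _] [h2 _]]. Qed.

Lemma is_pderiv_near i f g x c : (\near x, f x = g x) ->
  is_pderiv i f x c -> is_pderiv i g x c.
Proof.
move=> fg [h1 h2]; split; [move: h1|move: h2]; apply: near_eq_is_derive;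
by apply: filterS fg => y; rewrite /repart /impart => ->.
Qed.

Lemma is_pderiv_cst i x c : is_pderiv i (fun=> c) x 0.
Proof. by split; apply: is_derive_cst. Qed.

Lemma is_pderiv_coord i j x :
  is_pderiv i (fun y => (y 0 j)%:C) x (i == j)%:R.
Proof.
have -> : ((i == j)%:R : C) = (((i == j)%:R : R))%:C by case: eqP.
split; last exact: is_derive_cst.
rewrite (_ : repart _ = fun y : pt => y 0 j) //=.
have dj : differentiable (fun y : pt => y 0 j) x by exact: differentiable_coord.
apply: DeriveDef; first exact: diff_derivable.
rewrite deriveE //.
(* A continuous linear map is its own differential, so the derivative along ['e_i] is the [j]-th
   entry of ['e_i]. *)
have lj : linear (fun y : pt => y 0 j : R^o) by move=> k u v; rewrite !mxE.
pose L : {linear pt -> R^o} :=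
  HB.pack (fun y : pt => y 0 j : R^o) (GRing.isLinear.Build _ _ _ _ _ lj).
have cL : continuous L by exact: coord_continuous.
by rewrite (_ : (fun y : pt => y 0 j) = L) // diff_lin //= !mxE eqxx eq_sym.
Qed.

Lemma is_pderivD i f g x c d : is_pderiv i f x c -> is_pderiv i g x d ->
  is_pderiv i (fun y => f y + g y) x (c + d).
Proof.
case: c d => [a b] [a' b'] [h1 h2] [h3 h4]; split => /=.
  rewrite (_ : repart _ = repart f + repart g); first exact: is_deriveD.
  by apply/funext => y; rewrite /repart !fctE; case: (f y); case: (g y).
rewrite (_ : impart _ = impart f + impart g); first exact: is_deriveD.
by apply/funext => y; rewrite /impart !fctE; case: (f y); case: (g y).
Qed.

Lemma is_pderivM i f g x c d : is_pderiv i f x c -> is_pderiv i g x d ->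
  is_pderiv i (fun y => f y * g y) x (c * g x + f x * d).
Proof.
case: c d => [a b] [a' b'] [h1 h2] [h3 h4]; split => /=.
  rewrite (_ : repart _ = repart f * repart g - impart f * impart g).
    apply: is_derive_eq (is_deriveB (is_deriveM h1 h3) (is_deriveM h2 h4)) _.
    rewrite /repart /impart.
    by case: (f x) (g x) => [? ?] [? ?] /=; rewrite /GRing.scale /=; ring.
  by apply/funext => y; rewrite /repart /impart !fctE; case: (f y); case: (g y).
rewrite (_ : impart _ = repart f * impart g + impart f * repart g).
  apply: is_derive_eq (is_deriveD (is_deriveM h1 h4) (is_deriveM h2 h3)) _.
  rewrite /repart /impart.
  by case: (f x) (g x) => [? ?] [? ?] /=; rewrite /GRing.scale /=; ring.
by apply/funext => y; rewrite /repart /impart !fctE; case: (f y); case: (g y).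
Qed.

Lemma is_pderivN i f x c : is_pderiv i f x c ->
  is_pderiv i (fun y => - f y) x (- c).
Proof.
move=> h; rewrite (_ : (fun _ => _) = fun y => -1 * f y); last first.
  by apply/funext => y; rewrite mulN1r.
by apply: is_pderiv_eq (is_pderivM (is_pderiv_cst _ _ _) h) _; ring.
Qed.

Lemma is_pderivB i f g x c d : is_pderiv i f x c -> is_pderiv i g x d ->
  is_pderiv i (fun y => f y - g y) x (c - d).
Proof. by move=> hf hg; apply: is_pderivD => //; exact: is_pderivN. Qed.

Lemma is_pderivX i f x c n : is_pderiv i f x c ->
  is_pderiv i (fun y => f y ^+ n) x (f x ^+ n.-1 *+ n * c).
Proof.
move=> h; elim: n => [|n IH].
  by rewrite mulr0n mul0r; exact: is_pderiv_cst.
rewrite (_ : (fun _ => _) = fun y => f y * f y ^+ n); last first.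
  by apply/funext => y; rewrite exprS.
apply: is_pderiv_eq (is_pderivM h IH) _ => /=.
case: n {IH} => [|n] /=; first by rewrite !expr0; ring.
by rewrite mulrSr exprS; ring.
Qed.

Lemma complex_sqnorm_eq0 (c : C) :
  (complex.Re c ^+ 2 + complex.Im c ^+ 2 == 0) = (c == 0).
Proof.
by case: c => a b /=; rewrite paddr_eq0 ?sqr_ge0 // !sqrf_eq0 eq_complex.
Qed.

(** Write 1/f as the conjugate of f divided by [n] = |f|^2. Both parts are then real quotients whose
    denominator does not vanish at [x]. *)
Lemma is_pderivV i f x c : f x != 0 -> is_pderiv i f x c ->
  is_pderiv i (fun y => (f y)^-1) x (- c * (f x)^-1 ^+ 2).
Proof.
move=> fx0; case: c => a b [h1 h2].
pose n := repart f ^+ 2 + impart f ^+ 2.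
have nx : n x != 0 by rewrite /n !fctE complex_sqnorm_eq0.
move: (nx); rewrite /n !fctE /repart /impart => nx'.
have [dn hn] : exists dn, is_derive x 'e_i n dn /\
    dn = 2 * (repart f x * a + impart f x * b).
  exists (2 * (repart f x * a + impart f x * b)); split; last by [].
  apply: is_derive_eq (is_deriveD (is_deriveX 2 h1) (is_deriveX 2 h2)) _.
  by rewrite /GRing.scale /=; ring.
have hV : is_derive x 'e_i (fun y => (n y)^-1) (- (n x)^-2 *: dn).
  case: hn => hn _; apply: DeriveDef; first exact: derivableV.
  by rewrite deriveV // derive_val.
case: hn => _ dnE; subst dn.
split => /=.
  rewrite (_ : repart _ = repart f * (fun y => (n y)^-1)); last first.
    by apply/funext => y; rewrite /n /repart /impart !fctE; case: (f y).
  apply: is_derive_eq.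
  rewrite /n !fctE /repart /impart; move: nx' {n nx h1 h2 hV}.
  case: (f x) fx0 => u v _ /= nx'; rewrite /GRing.scale /=.
  by field.
rewrite (_ : impart _ = (- impart f) * (fun y => (n y)^-1)); last first.
  by apply/funext => y; rewrite /n /repart /impart !fctE; case: (f y) => ? ? /=; rewrite mulNr.
apply: is_derive_eq.
rewrite /n !fctE /repart /impart; move: nx' {n nx h1 h2 hV}.
case: (f x) fx0 => u v _ /= nx'; rewrite /GRing.scale /=.
by field.
Qed.

(** * Continuity of complex-valued functions through real and imaginary parts *)

Definition ccontinuous f x : Prop :=
  {for x, continuous (repart f)} /\ {for x, continuous (impart f)}.

Lemma ccontinuous_near f g x : (\near x, f x = g x) ->
  ccontinuous f x -> ccontinuous g x.
Proof.
move=> fg [h1 h2]; have fgx := nbhs_singleton fg.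
split; [move: h1|move: h2]; rewrite /prop_for /continuous_at /repart /impart fgx;
  apply: cvg_trans; apply: near_eq_cvg;
  [exact: nbhs_filter x| |exact: nbhs_filter x|];
  by apply: filterS fg => y ->.
Qed.

Lemma ccontinuous_cst x c : ccontinuous (fun=> c) x.
Proof. by split; exact: cst_continuous. Qed.

Lemma ccontinuous_coord j x : ccontinuous (fun y => (y 0 j)%:C) x.
Proof.
split; last exact: cst_continuous.
exact: (@coord_continuous R^o 1 4 0 j x).
Qed.

Lemma ccontinuousD f g x : ccontinuous f x -> ccontinuous g x ->
  ccontinuous (fun y => f y + g y) x.
Proof.
move=> [h1 h2] [h3 h4]; split.
  rewrite (_ : repart _ = repart f + repart g); first exact: continuousD.
  by apply/funext => y; rewrite /repart !fctE; case: (f y); case: (g y).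
rewrite (_ : impart _ = impart f + impart g); first exact: continuousD.
by apply/funext => y; rewrite /impart !fctE; case: (f y); case: (g y).
Qed.

Lemma ccontinuousM f g x : ccontinuous f x -> ccontinuous g x ->
  ccontinuous (fun y => f y * g y) x.
Proof.
move=> [h1 h2] [h3 h4]; split.
  rewrite (_ : repart _ = repart f * repart g - impart f * impart g).
    by apply: continuousB; apply: continuousM.
  by apply/funext => y; rewrite /repart /impart !fctE; case: (f y); case: (g y).
rewrite (_ : impart _ = repart f * impart g + impart f * repart g).
  by apply: continuousD; apply: continuousM.
by apply/funext => y; rewrite /repart /impart !fctE; case: (f y); case: (g y).
Qed.

Lemma ccontinuousV f x : f x != 0 -> ccontinuous f x ->
  ccontinuous (fun y => (f y)^-1) x.
Proof.
move=> fx0 [h1 h2].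
pose n := repart f * repart f + impart f * impart f.
have nx : n x != 0 by rewrite /n !fctE -!expr2 complex_sqnorm_eq0.
have cn : {for x, continuous (fun y => (n y)^-1)}.
  by apply: continuousV => //; apply: continuousD; apply: continuousM.
split.
  rewrite (_ : repart _ = repart f * (fun y => (n y)^-1)); last first.
    by apply/funext => y; rewrite /n /repart /impart !fctE; case: (f y).
  exact: continuousM.
rewrite (_ : impart _ = (- impart f) * (fun y => (n y)^-1)); last first.
  by apply/funext => y; rewrite /n /repart /impart !fctE; case: (f y) => ? ? /=; rewrite mulNr.
by apply: continuousM => //; exact: continuousN.
Qed.

(** * Closure properties of the classes C^k on an open set *)

Lemma Ck_continuous k U f x : Ck k U f -> U x -> ccontinuous f x.
Proof. by case: k => [|k] [h _]; exact: h. Qed.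

Lemma CkS_is_pderiv k U f i x : Ck k.+1 U f -> U x ->
  is_pderiv i f x (pderiv i f x).
Proof. by move=> [_ /(_ i)[h _]] Ux; apply: is_pderivP; exact: h. Qed.

Lemma CkS_pderiv k U f i : Ck k.+1 U f -> Ck k U (pderiv i f).
Proof. by move=> [_ /(_ i)[]]. Qed.

Lemma CkW k U f : Ck k.+1 U f -> Ck k U f.
Proof.
elim: k f => [|k IH] f [hc hd]; first by split.
by split=> // i; have [h1 h2] := hd i; split => //; exact: IH.
Qed.

(** Openness turns equality on [U] into equality near each of its points, which transports
    continuity and partial derivatives. The partial derivatives then agree on [U] again, and the
    induction continues with them. *)
Lemma eq_Ck k U f g : open U -> {in U, f =1 g} -> Ck k U f -> Ck k U g.
Proof.
move=> oU; elim: k f g => [|k IH] f g fg.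
all: have nfg y : U y -> (\near y, f y = g y).
1,3: by move=> Uy; apply: filterS (open_nbhs_nbhs (conj oU Uy)) => z Uz;
  apply: fg; rewrite inE.
  move=> [h _]; split=> // y Uy; apply: ccontinuous_near (h _ Uy); exact: nfg.
move=> h; split.
  by move=> y Uy; apply: ccontinuous_near (Ck_continuous h Uy); exact: nfg.
move=> i; have hp y (Uy : U y) := is_pderiv_near (nfg _ Uy) (CkS_is_pderiv i h Uy).
split; first by move=> y Uy; exact: is_pderiv_derivable (hp _ Uy).
apply: IH (CkS_pderiv i h) => y; rewrite inE => Uy.
by rewrite (is_pderiv_val (hp _ Uy)).
Qed.

(** Lets a closed formula [df] stand for the literal [pderiv i f] in the definition of [Ck]; by
    [eq_Ck] it only has to be right on [U]. *)
Lemma CkS_intro k U f (df : 'I_4 -> pt -> C) : open U ->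
  (forall x, U x -> ccontinuous f x) ->
  (forall i x, U x -> is_pderiv i f x (df i x)) ->
  (forall i, Ck k U (df i)) -> Ck k.+1 U f.
Proof.
move=> oU cf hf hd; split=> // i; split.
  by move=> x Ux; exact: is_pderiv_derivable (hf i _ Ux).
apply: eq_Ck (hd i) => // x; rewrite inE => Ux.
by rewrite (is_pderiv_val (hf i _ Ux)).
Qed.

Lemma Ck_cst k U c : open U -> Ck k U (fun=> c).
Proof.
move=> oU; elim: k c => [|k IH] c.
  by split=> // x _; exact: ccontinuous_cst.
apply: (@CkS_intro _ _ _ (fun _ _ => 0)) => //.
  by move=> x _; exact: ccontinuous_cst.
by move=> i x _; exact: is_pderiv_cst.
Qed.

Lemma Ck_coord k U j : open U -> Ck k U (fun y => (y 0 j)%:C).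
Proof.
move=> oU; case: k => [|k].
  by split=> // x _; exact: ccontinuous_coord.
apply: (@CkS_intro _ _ _ (fun i _ => (i == j)%:R)) => //.
- by move=> x _; exact: ccontinuous_coord.
- by move=> i x _; exact: is_pderiv_coord.
- by move=> i; exact: Ck_cst.
Qed.

Lemma CkD k U f g : open U -> Ck k U f -> Ck k U g ->
  Ck k U (fun y => f y + g y).
Proof.
move=> oU; elim: k f g => [|k IH] f g hf hg.
  by split=> // x Ux; apply: ccontinuousD; [exact: Ck_continuous hf Ux|exact: Ck_continuous hg Ux].
apply: (@CkS_intro _ _ _ (fun i y => pderiv i f y + pderiv i g y)) => //.
- by move=> x Ux; apply: ccontinuousD; [exact: Ck_continuous hf Ux|exact: Ck_continuous hg Ux].
- by move=> i x Ux; apply: is_pderivD; [exact: CkS_is_pderiv hf Ux|exact: CkS_is_pderiv hg Ux].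
- by move=> i; apply: IH; exact: CkS_pderiv.
Qed.

Lemma CkM k U f g : open U -> Ck k U f -> Ck k U g ->
  Ck k U (fun y => f y * g y).
Proof.
move=> oU; elim: k f g => [|k IH] f g hf hg.
  by split=> // x Ux; apply: ccontinuousM; [exact: Ck_continuous hf Ux|exact: Ck_continuous hg Ux].
apply: (@CkS_intro _ _ _ (fun i y => pderiv i f y * g y + f y * pderiv i g y)) => //.
- by move=> x Ux; apply: ccontinuousM; [exact: Ck_continuous hf Ux|exact: Ck_continuous hg Ux].
- by move=> i x Ux; apply: is_pderivM; [exact: CkS_is_pderiv hf Ux|exact: CkS_is_pderiv hg Ux].
- by move=> i; apply: CkD => //; apply: IH; (try exact: CkS_pderiv); exact: CkW.
Qed.

(** The derivative -f'/f^2 contains 1/f again, but one class lower, where the induction hypothesis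
    supplies it. It is written as a product so that [CkM] applies. *)
Lemma CkV k U f : open U -> (forall x, U x -> f x != 0) -> Ck k U f ->
  Ck k U (fun y => (f y)^-1).
Proof.
move=> oU f0; elim: k => [|k IH] hf.
  by split=> // x Ux; apply: ccontinuousV; [exact: f0|exact: Ck_continuous hf Ux].
apply: (@CkS_intro _ _ _ (fun i y => (-1 * pderiv i f y) * ((f y)^-1 * (f y)^-1))) => //.
- by move=> x Ux; apply: ccontinuousV; [exact: f0|exact: Ck_continuous hf Ux].
- move=> i x Ux; apply: is_pderiv_eq (is_pderivV (f0 _ Ux) (CkS_is_pderiv i hf Ux)) _.
  by rewrite mulN1r expr2.
- move=> i; have hV := IH (CkW hf).
  by do 2?apply: CkM => //; [exact: Ck_cst|exact: CkS_pderiv].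
Qed.

(* Differentiating [s ^ 2 = f] gives [s' = f' / (2 s)], so regularity of [s]
   bootstraps from that of [f]. *)
Lemma Ck_sqrt k U f s : open U -> (forall x, s x ^+ 2 = f x) ->
  (forall x, U x -> f x != 0) ->
  (forall x, U x -> ccontinuous s x) ->
  (forall i x, U x ->
     derivable (repart s) x 'e_i /\ derivable (impart s) x 'e_i) ->
  Ck k U f -> Ck k U s.
Proof.
move=> oU sf f0 cs ds.
have s0 x : U x -> s x != 0 by move=> /f0; rewrite -sf sqrf_eq0.
elim: k => [|k IH] hf; first by split.
apply: (@CkS_intro _ _ _ (fun i y => pderiv i f y * (2^-1 * (s y)^-1))) => //.
- move=> i x Ux; have hs := is_pderivP (ds i x Ux).
  apply: (is_pderiv_eq hs).
  have := is_pderivX 2 hs; rewrite (_ : (fun _ => _) = f); last exact/funext.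
  by move=> /is_pderiv_val ->; have := s0 _ Ux; move: (s x) => w w0; field.
- move=> i; have hs := IH (CkW hf).
  by do 2?apply: CkM => //; [exact: CkS_pderiv|exact: Ck_cst|exact: CkV].
Qed.

(** * Smooth functions as the intersection of all classes C^k *)

Lemma smooth_is_pderiv U f i x : smooth_on U f -> U x ->
  is_pderiv i f x (pderiv i f x).
Proof. by move=> /(_ 1%N) h; exact: CkS_is_pderiv h. Qed.

Lemma smooth_cst U c : open U -> smooth_on U (fun=> c).
Proof. by move=> oU k; exact: Ck_cst. Qed.

Lemma smooth_coord U j : open U -> smooth_on U (fun y => (y 0 j)%:C).
Proof. by move=> oU k; exact: Ck_coord. Qed.

Lemma smoothD U f g : open U -> smooth_on U f -> smooth_on U g ->
  smooth_on U (fun y => f y + g y).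
Proof. by move=> oU hf hg k; exact: CkD. Qed.

Lemma smoothM U f g : open U -> smooth_on U f -> smooth_on U g ->
  smooth_on U (fun y => f y * g y).
Proof. by move=> oU hf hg k; exact: CkM. Qed.

Lemma smoothV U f : open U -> (forall x, U x -> f x != 0) -> smooth_on U f ->
  smooth_on U (fun y => (f y)^-1).
Proof. by move=> oU f0 hf k; exact: CkV. Qed.

Lemma smoothN U f : open U -> smooth_on U f -> smooth_on U (fun y => - f y).
Proof.
move=> oU hf; rewrite (_ : (fun _ => _) = fun y => -1 * f y).
  by apply: smoothM => //; exact: smooth_cst.
by apply/funext => y; rewrite mulN1r.
Qed.

Lemma smoothX U f n : open U -> smooth_on U f ->
  smooth_on U (fun y => f y ^+ n).
Proof.
move=> oU hf; elim: n => [|n IH]; first exact: smooth_cst.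
rewrite (_ : (fun _ => _) = fun y => f y * f y ^+ n); first exact: smoothM.
by apply/funext => y; rewrite exprS.
Qed.

End ComplexCalculus.

(** * Nonvanishing sets, the principal square root along a line, finite sums *)

Section OpenAndRoots.
Variable R : realType.
Local Notation C := R[i].
Local Notation pt := 'rV[R]_4.

Lemma open_neq0 (f : pt -> C) : (forall x, ccontinuous f x) ->
  open [set x | f x != 0].
Proof.
move=> cf; pose n := repart f * repart f + impart f * impart f.
have cn : continuous n.
  by move=> x; have [h1 h2] := cf x; apply: continuousD; apply: continuousM.
rewrite (_ : [set x | _] = n @^-1` [set r | r != 0]); last first.
  by apply/funext => x; rewrite /n /preimage /= !fctE -!expr2 complex_sqnorm_eq0.
by apply: open_comp => [x _|]; [exact: cn|exact: open_neq].
Qed.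

Lemma derivable_sqrt (h : R -> R) t : 0 < h t -> derivable h t 1 ->
  derivable (fun s => Num.sqrt (h s)) t 1.
Proof.
move=> h0 /derivable1_diffP dh; apply/derivable1_diffP.
apply: (differentiable_comp dh); apply/derivable1_diffP.
by have [] := is_derive1_sqrt h0.
Qed.

(** The principal root uses the sign +1 when the imaginary part is 0, so along the branch cut it
    stays on the positive imaginary axis. It is therefore regular along the cut, although it jumps
    across it. *)
Lemma sqrtc_neg (r : R) : r < 0 -> sqrtc r%:C = 0 +i* Num.sqrt (- r).
Proof.
move=> r0; rewrite /sqrtc /= eqxx mul1r expr0n /= addr0 sqrtr_sqr ltr0_norm //.
by rewrite addNr mul0r sqrtr0; congr (_ +i* Num.sqrt _); field.
Qed.

Lemma derivable_add (h k : R -> R) t : derivable h t 1 -> derivable k t 1 ->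
  derivable (fun s => h s + k s) t 1.
Proof. exact: derivableD. Qed.

Lemma derivable_mul (h k : R -> R) t : derivable h t 1 -> derivable k t 1 ->
  derivable (fun s => h s * k s) t 1.
Proof. exact: derivableM. Qed.

Lemma derivable_const (c t : R) : derivable (fun=> c) t 1.
Proof. exact: derivable_cst. Qed.

Lemma derivable_mul_sqr (c t : R) : derivable (fun s : R => c * s ^+ 2) t 1.
Proof.
apply: derivable_mul; first exact: derivable_const.
by apply: derivable_mul; exact: derivable_id.
Qed.

Lemma derivable_sqr_affine (b c t : R) :
  derivable (fun s : R => b + c * s ^+ 2) t 1.
Proof.
by apply: derivable_add; [exact: derivable_const|exact: derivable_mul_sqr].
Qed.

Lemma derivable_sqrtc_line (g : C) (t : R) : real_or_imaginary g ->
  1 + g * t%:C ^+ 2 != 0 ->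
  derivable (fun s : R => complex.Re (sqrtc (1 + g * s%:C ^+ 2))) t 1 /\
  derivable (fun s : R => complex.Im (sqrtc (1 + g * s%:C ^+ 2))) t 1.
Proof.
case: g => a b [] h; rewrite /= in h; rewrite {}h.
  set r := fun s : R => 1 + a * s ^+ 2.
  have rE s : 1 + (a +i* 0) * s%:C ^+ 2 = (r s)%:C.
    by rewrite /r; simpc; apply/eqP; rewrite eq_complex /=; apply/andP; split;
      apply/eqP; ring.
  have rc : {for t, continuous r}.
    apply/differentiable_continuous/derivable1_diffP; exact: derivable_sqr_affine.
  rewrite rE => rt0; have {rt0} : r t != 0 by apply: contra rt0 => /eqP ->.
  (* By continuity [r] keeps its sign near [t]; on either side one part of the root is locally 0 and
     the other is a real square root of a positive function. *)
  rewrite neq_lt => /orP[rt|rt].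
    have nr : \near t, r t < 0 by exact: (cvgr_lt (r t) rc).
    split.
      apply: (@near_eq_derivable _ _ _ (cst 0)); last exact: derivable_cst.
      by apply: filterS nr => s rs; rewrite rE sqrtc_neg.
    apply: (@near_eq_derivable _ _ _ (fun s => Num.sqrt (- r s))).
      by apply: filterS nr => s rs; rewrite rE sqrtc_neg.
    apply: derivable_sqrt; first by rewrite oppr_gt0.
    by apply: (@derivableN _ _ _ r); exact: derivable_sqr_affine.
  have nr : \near t, 0 < r t by exact: (cvgr_gt (r t) rc).
  split.
    apply: (@near_eq_derivable _ _ _ (fun s => Num.sqrt (r s))).
      by apply: filterS nr => s rs; rewrite rE sqrtc_sqrtr // lecR ltW.
    by apply: derivable_sqrt => //; exact: derivable_sqr_affine.
  apply: (@near_eq_derivable _ _ _ (cst 0)); last exact: derivable_cst.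
  by apply: filterS nr => s rs; rewrite rE sqrtc_sqrtr // lecR ltW.
move=> _.
have rE s : 1 + (0 +i* b) * s%:C ^+ 2 = 1 +i* (b * s ^+ 2).
  by simpc; apply/eqP; rewrite eq_complex /=; apply/andP; split;
    apply/eqP; ring.
(* [u] is the modulus of 1 + i b s^2 and [v] the real part of its root; both are positive because
   the real part of the radicand is 1. *)
pose u s := Num.sqrt (1 + (b * s ^+ 2) ^+ 2).
have u0 s : 0 < u s by rewrite sqrtr_gt0 ltr_wpDr // sqr_ge0.
pose v s := Num.sqrt ((u s + 1) / 2).
have v0 s : 0 < v s by rewrite sqrtr_gt0 divr_gt0 // addr_gt0.
have vE s : complex.Re (sqrtc (1 + (0 +i* b) * s%:C ^+ 2)) = v s.
  by rewrite rE /sqrtc /= expr1n.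
(* For w^2 = z one has Im z = 2 Re w Im w. Dividing by 2 Re w avoids the discontinuous sign factor
   in the definition of the root. *)
have wE s : complex.Im (sqrtc (1 + (0 +i* b) * s%:C ^+ 2)) = b * s ^+ 2 * (2 * v s)^-1.
  have := sqr_sqrtc (1 + (0 +i* b) * s%:C ^+ 2); rewrite -vE.
  have := v0 s; rewrite -vE rE; case: (sqrtc _) => c d /= c0.
  move=> /(congr1 (@complex.Im R)) /= <-; field; lra.
have db : derivable (fun s : R => b * s ^+ 2) t 1 by exact: derivable_mul_sqr.
have du : derivable u t 1.
  apply: derivable_sqrt; first by rewrite ltr_wpDr // sqr_ge0.
  by exact: (derivable_add (@derivable_const 1 t) (derivable_mul db db)).
have dv : derivable v t 1.
  apply: derivable_sqrt; first by rewrite divr_gt0 // addr_gt0.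
  exact: (@derivable_mul (fun s => u s + 1) (fun=> 2^-1) t
    (derivable_add du (@derivable_const 1 t)) (@derivable_const _ t)).
split; first by rewrite (_ : (fun _ => _) = v) //; exact/funext.
rewrite (_ : (fun _ => _) = fun s => b * s ^+ 2 * (2 * v s)^-1); last exact/funext.
apply: (@derivable_mul (fun s => b * s ^+ 2) (fun s => (2 * v s)^-1) t db).
apply: (@derivableV _ _ (fun s => 2 * v s)); first by rewrite mulf_neq0 // gt_eqF.
exact: (@derivable_mul (fun=> 2) v t (@derivable_const _ t) dv).
Qed.

Lemma is_pderiv_sum n i (f : 'I_n -> pt -> C) x (c : 'I_n -> C) :
  (forall k, is_pderiv i (f k) x (c k)) ->
  is_pderiv i (fun y => \sum_k f k y) x (\sum_k c k).
Proof.
move=> h; elim: n f c h => [|n IH] f c h.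
  rewrite big_ord0 (_ : (fun _ => _) = fun=> 0); first exact: is_pderiv_cst.
  by apply/funext => y; rewrite big_ord0.
rewrite big_ord_recl.
rewrite (_ : (fun _ => _) = fun y => f ord0 y + \sum_k f (lift ord0 k) y).
  by apply: is_pderivD => //; exact: IH.
by apply/funext => y; rewrite big_ord_recl.
Qed.

Lemma smooth_sum n (U : set pt) (f : 'I_n -> pt -> C) : open U ->
  (forall k, smooth_on U (f k)) -> smooth_on U (fun y => \sum_k f k y).
Proof.
move=> oU h; elim: n f h => [|n IH] f h.
  rewrite (_ : (fun _ => _) = fun=> 0); first exact: smooth_cst.
  by apply/funext => y; rewrite big_ord0.
rewrite (_ : (fun _ => _) = fun y => f ord0 y + \sum_k f (lift ord0 k) y).
  by apply: smoothD => //; exact: IH.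
by apply/funext => y; rewrite big_ord_recl.
Qed.

End OpenAndRoots.

(** * Pointwise formulas for the Nijenhuis and Haantjes torsions *)

Section Torsion.
Variable R : realType.
Local Notation C := R[i].
Local Notation pt := 'rV[R]_4.
Implicit Types (L : opfield R) (X Y : vfield R) (x : pt) (v w : 'cV[C]_4).

Definition vdir X x v : 'cV[C]_4 :=
  \col_i \sum_j v j 0 * pderiv j (fun y => X y i 0) x.

Definition opdir L x v : 'M[C]_4 :=
  \matrix_(i, k) \sum_j v j 0 * pderiv j (fun y => L y i k) x.

Definition torsion_at L x v w : 'cV[C]_4 :=
  opdir L x (L x *m v) *m w - opdir L x (L x *m w) *m v
  - L x *m (opdir L x v *m w - opdir L x w *m v).

Lemma smooth_op_app L X :
  smooth_opfield L -> smooth_vfield X -> smooth_vfield (op_app L X).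
Proof.
move=> hL hX i.
rewrite (_ : (fun _ => _) = fun x => \sum_j L x i j * X x j 0); last first.
  by apply/funext => x; rewrite mxE.
have oT := @openT pt.
by apply: smooth_sum => [|j]; [exact: oT|apply: smoothM; [exact: oT|exact: hL|exact: hX]].
Qed.

Lemma lie_bracketE X Y x : lie_bracket X Y x = vdir Y x (X x) - vdir X x (Y x).
Proof. by apply/colP => i; rewrite !mxE -sumrB. Qed.

(** Leibniz rule for a matrix times a column, after exchanging the sum over directions with that of
    the matrix product. *)
Lemma vdir_op_app L X x v : smooth_opfield L -> smooth_vfield X ->
  vdir (op_app L X) x v = opdir L x v *m X x + L x *m vdir X x v.
Proof.
move=> hL hX; apply/colP => i; rewrite !mxE.
have pE j : pderiv j (fun y => op_app L X y i 0) x =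
    \sum_k (pderiv j (fun y => L y i k) x * X x k 0
            + L x i k * pderiv j (fun y => X y k 0) x).
  rewrite (_ : (fun _ => _) = fun y => \sum_k L y i k * X y k 0); last first.
    by apply/funext => y; rewrite mxE.
  apply: is_pderiv_val; apply: is_pderiv_sum => k.
  by apply: is_pderivM; [apply: smooth_is_pderiv (hL i k) _|apply: smooth_is_pderiv (hX k) _].
under eq_bigr do rewrite pE big_split /= mulrDr.
rewrite big_split /=; congr (_ + _).
  under eq_bigr do rewrite mulr_sumr.
  rewrite exchange_big; apply: eq_bigr => k _; rewrite mxE mulr_suml.
  by apply: eq_bigr => j _; rewrite mulrA.
under eq_bigr do rewrite mulr_sumr.
rewrite exchange_big; apply: eq_bigr => k _; rewrite mxE mulr_sumr.
by apply: eq_bigr => j _; rewrite mulrCA.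
Qed.

Lemma nijenhuis_torsionE L X Y x :
  smooth_opfield L -> smooth_vfield X -> smooth_vfield Y ->
  nijenhuis_torsion L X Y x = torsion_at L x (X x) (Y x).
Proof.
move=> hL hX hY.
have eX v := vdir_op_app x v hL hX; have eY v := vdir_op_app x v hL hY.
rewrite -[LHS]/(L x *m (L x *m lie_bracket X Y x)
  + lie_bracket (op_app L X) (op_app L Y) x
  - L x *m (lie_bracket X (op_app L Y) x + lie_bracket (op_app L X) Y x)).
rewrite !lie_bracketE !eX !eY.
rewrite -[op_app L X x]/(L x *m X x) -[op_app L Y x]/(L x *m Y x) /torsion_at.
rewrite !(mulmxDr, mulmxN).
(* The first four columns carry all derivatives of [X] and [Y] and cancel in pairs; the other four
   make up [torsion_at]. Treated as unknowns, they leave a linear identity. *)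
move: (L x *m (L x *m vdir X x (Y x))) (L x *m (L x *m vdir Y x (X x)))
  (L x *m vdir Y x (L x *m X x)) (L x *m vdir X x (L x *m Y x))
  (L x *m (opdir L x (X x) *m Y x)) (L x *m (opdir L x (Y x) *m X x))
  (opdir L x (L x *m X x) *m Y x) (opdir L x (L x *m Y x) *m X x) => *.
by apply/colP => i; rewrite !mxE; ring.
Qed.

(** The Nijenhuis torsion sees only point values, so replacing a field by its image under [L] merely
    multiplies the argument of [t] by [L x]; no second derivatives survive. *)
Lemma haantjes_torsionE L X Y x (t := torsion_at L x) :
  smooth_opfield L -> smooth_vfield X -> smooth_vfield Y ->
  haantjes_torsion L X Y x =
    L x *m (L x *m t (X x) (Y x)) + t (L x *m X x) (L x *m Y x)
    - L x *m (t (X x) (L x *m Y x) + t (L x *m X x) (Y x)).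
Proof.
move=> hL hX hY; have hLX := smooth_op_app hL hX; have hLY := smooth_op_app hL hY.
rewrite -[LHS]/(L x *m (L x *m nijenhuis_torsion L X Y x)
  + nijenhuis_torsion L (op_app L X) (op_app L Y) x
  - L x *m (nijenhuis_torsion L X (op_app L Y) x
            + nijenhuis_torsion L (op_app L X) Y x)).
rewrite (nijenhuis_torsionE x hL hX hY) (nijenhuis_torsionE x hL hLX hLY).
by rewrite (nijenhuis_torsionE x hL hX hLY) (nijenhuis_torsionE x hL hLX hY).
Qed.

End Torsion.

(** * Differentiation and smoothness by recursion on arithmetic expressions *)

Ltac is_pderiv_tac :=
  lazymatch goal with
  | |- is_pderiv _ (fun y => (@?f y + - @?g y)%R) _ _ =>
      apply: (@is_pderivB _ _ f g); is_pderiv_tac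
  | |- is_pderiv _ (fun y => (@?f y + @?g y)%R) _ _ =>
      apply: (@is_pderivD _ _ f g); is_pderiv_tac
  | |- is_pderiv _ (fun y => (- @?f y)%R) _ _ =>
      apply: (@is_pderivN _ _ f); is_pderiv_tac
  | |- is_pderiv _ (fun _ => ?c) _ _ => apply: is_pderiv_cst
  | |- is_pderiv _ (fun y => (@?f y * @?g y)%R) _ _ =>
      apply: (@is_pderivM _ _ f g); is_pderiv_tac
  | |- is_pderiv _ (fun y => (@?f y ^+ ?n)%R) _ _ =>
      apply: (@is_pderivX _ _ f _ _ n); is_pderiv_tac
  | |- is_pderiv _ (fun y => (@?f y)^-1%R) _ _ =>
      apply: (@is_pderivV _ _ f); [|is_pderiv_tac]
  | |- is_pderiv _ (@q1 _) _ _ => apply: is_pderiv_coord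
  | |- is_pderiv _ (@q2 _) _ _ => apply: is_pderiv_coord
  | |- is_pderiv _ (@p1 _) _ _ => apply: is_pderiv_coord
  | |- is_pderiv _ (@p2 _) _ _ => apply: is_pderiv_coord
  | |- is_pderiv _ (fun y => q1 y) _ _ => apply: is_pderiv_coord
  | |- is_pderiv _ (fun y => q2 y) _ _ => apply: is_pderiv_coord
  | |- is_pderiv _ (fun y => p1 y) _ _ => apply: is_pderiv_coord
  | |- is_pderiv _ (fun y => p2 y) _ _ => apply: is_pderiv_coord
  | |- _ => eassumption
  end.

Ltac smooth_tac :=
  lazymatch goal with
  | |- smooth_on _ (fun _ => ?c) => apply: smooth_cst
  | |- smooth_on _ (fun y => (@?f y + @?g y)%R) =>
      apply: (@smoothD _ _ f g); [|smooth_tac|smooth_tac]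
  | |- smooth_on _ (fun y => (- @?f y)%R) =>
      apply: (@smoothN _ _ f); [|smooth_tac]
  | |- smooth_on _ (fun y => (@?f y * @?g y)%R) =>
      apply: (@smoothM _ _ f g); [|smooth_tac|smooth_tac]
  | |- smooth_on _ (fun y => (@?f y ^+ ?n)%R) =>
      apply: (@smoothX _ _ f n); [|smooth_tac]
  | |- smooth_on _ (fun y => (@?f y)^-1%R) =>
      apply: (@smoothV _ _ f); [| |smooth_tac]
  | |- smooth_on _ (fun y => q1 y) => apply: smooth_coord
  | |- smooth_on _ (fun y => q2 y) => apply: smooth_coord
  | |- smooth_on _ (fun y => p1 y) => apply: smooth_coord
  | |- smooth_on _ (fun y => p2 y) => apply: smooth_coord
  | |- _ => try eassumption
  end.

(** * Explicit linear algebra in dimension four *)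

Section FourDimensions.
Variable R : realType.
Local Notation C := R[i].
Local Notation pt := 'rV[R]_4.

Lemma forall_ord4 (P : 'I_4 -> Prop) : P 0 -> P 1 -> P 2 -> P 3 -> forall i, P i.
Proof.
by move=> P0 P1 P2 P3 [[|[|[|[|//]]]] h];
  [move: P0|move: P1|move: P2|move: P3]; congr P; apply: val_inj.
Qed.

Lemma sum_ord4 (V : nmodType) (F : 'I_4 -> V) :
  \sum_i F i = F 0 + F 1 + F 2 + F 3.
Proof.
rewrite !big_ord_recl big_ord0 addr0 !addrA.
by congr (F _ + F _ + F _ + F _); apply: val_inj.
Qed.

Lemma ord4_eqE :
  (((0 : 'I_4) == 1) = false) * (((0 : 'I_4) == 2) = false) *
  (((0 : 'I_4) == 3) = false) * (((1 : 'I_4) == 0) = false) *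
  (((1 : 'I_4) == 2) = false) * (((1 : 'I_4) == 3) = false) *
  (((2 : 'I_4) == 0) = false) * (((2 : 'I_4) == 1) = false) *
  (((2 : 'I_4) == 3) = false) * (((3 : 'I_4) == 0) = false) *
  (((3 : 'I_4) == 1) = false) * (((3 : 'I_4) == 2) = false).
Proof. by []. Qed.

Lemma qpixE : (qix 0 = 0) * (qix 1 = 1) * (pix 0 = 2) * (pix 1 = 3).
Proof. by do !split; apply: val_inj. Qed.

Lemma sum_ord2 (V : nmodType) (F : 'I_2 -> V) : \sum_i F i = F 0 + F 1.
Proof.
by rewrite !big_ord_recl big_ord0 addr0; congr (F _ + F _); apply: val_inj.
Qed.

Lemma forall_ord2 (P : 'I_2 -> Prop) : P 0 -> P 1 -> forall i, P i.
Proof.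
by move=> P0 P1 [[|[|//]] h]; [move: P0|move: P1]; congr P; apply: val_inj.
Qed.

Definition col4 (a b c d : C) : 'cV[C]_4 := \col_i nth 0 [:: a; b; c; d] i.

Lemma col4E (v : 'cV[C]_4) : v = col4 (v 0 0) (v 1 0) (v 2 0) (v 3 0).
Proof. by apply/colP; apply: forall_ord4; rewrite mxE. Qed.

Lemma col4_coord a b c d :
  (col4 a b c d 0 0 = a) * (col4 a b c d 1 0 = b) *
  (col4 a b c d 2 0 = c) * (col4 a b c d 3 0 = d).
Proof. by rewrite !mxE. Qed.

Lemma col4D a b c d a' b' c' d' :
  col4 a b c d + col4 a' b' c' d' = col4 (a + a') (b + b') (c + c') (d + d').
Proof. by apply/colP; apply: forall_ord4; rewrite !mxE. Qed.

Lemma col4N a b c d : - col4 a b c d = col4 (- a) (- b) (- c) (- d).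
Proof. by apply/colP; apply: forall_ord4; rewrite !mxE. Qed.

Lemma mulmx4 m (A : 'M[C]_4) (B : 'M[C]_(4, m)) i j :
  (A *m B) i j = A i 0 * B 0 j + A i 1 * B 1 j + A i 2 * B 2 j + A i 3 * B 3 j.
Proof. by rewrite mxE sum_ord4. Qed.

Lemma smooth_mx4 (s : pt -> seq (seq C)) :
  (forall i j : 'I_4, smooth_on setT (fun x => nth 0 (nth [::] (s x) i) j)) ->
  smooth_opfield (fun x => mx4 (s x)).
Proof.
move=> h i j; rewrite (_ : (fun _ => _) = fun x => nth 0 (nth [::] (s x) i) j) //.
by apply/funext => x; rewrite mxE.
Qed.

(** The derivative is linear in the direction, so tables of partial derivatives along the four frame
    vectors determine it. *)
Lemma opdir_mx4 (s : pt -> seq (seq C)) (ds : 'I_4 -> seq (seq C)) x v :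
  (forall k i j : 'I_4, is_pderiv k (fun y => nth 0 (nth [::] (s y) i) j) x
     (nth 0 (nth [::] (ds k) i) j)) ->
  opdir (fun y => mx4 (s y)) x v = \sum_k v k 0 *: mx4 (ds k).
Proof.
move=> h; apply/matrixP => i j; rewrite summxE mxE; apply: eq_bigr => k _.
rewrite !mxE (_ : (fun _ => _) = fun y => nth 0 (nth [::] (s y) i) j).
  by rewrite (is_pderiv_val (h k i j)).
by apply/funext => y; rewrite mxE.
Qed.

(* Up to the order (0, 1, 3, 2) of the basis, this matrix is lower triangular. *)
Lemma char_poly_mx4 (a b c d e f g h k l : C) :
  char_poly (mx4 [:: [:: a; 0; 0; 0]; [:: b; c; 0; 0];
                     [:: d; e; f; g]; [:: h; k; 0; l]]) =
  \prod_(z <- [:: a; c; f; l]) ('X - z%:P).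
Proof.
rewrite /char_poly; set M : 'M_(2 + 2) := char_poly_mx _.
have ur0 : ursubmx M = 0.
  apply/matrixP; apply: forall_ord2; apply: forall_ord2;
  by rewrite !mxE /= subr0.
rewrite -[LHS]/(@determinant _ (2 + 2) M) -[M]submxK ur0 det_lblock det_trig; last first.
  apply/is_trig_mxP; apply: forall_ord2; apply: forall_ord2 => // _;
  by rewrite !mxE /= subr0.
(* The lower right block is upper triangular, whereas [det_trig] expects a lower triangular matrix;
   hence the transposition. *)
rewrite -det_tr det_trig; last first.
  apply/is_trig_mxP; apply: forall_ord2; apply: forall_ord2 => // _;
  by rewrite !mxE /= subr0.
rewrite !big_ord_recl !big_ord0 !big_cons big_nil !mulr1 !mxE /=.
by rewrite !mulrA.
Qed.

End FourDimensions.

(** * Torsions of [K_I2] and [N_I2] *)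

Section Operators.
Variables (R : realType) (g : R[i]).
Local Notation C := R[i].
Local Notation pt := 'rV[R]_4.
Local Notation K := (K_I2 g).
Local Notation N := (N_I2 g).

Lemma K_I2_mul x a b c d : K x *m col4 a b c d = col4 0
  (- g * q1 x * q2 x * a + (1 + g * q1 x ^+ 2) * b)
  (- g * q1 x * p2 x * b - g * q1 x * q2 x * d)
  (g * q1 x * p2 x * a + (1 + g * q1 x ^+ 2) * d).
Proof.
by apply/colP; apply: forall_ord4; rewrite mulmx4 !mxE /=; ring.
Qed.

Lemma opdir_K_I2 x (v w : 'cV[C]_4) (a := v 0 0) (b := v 1 0) (d := v 3 0) :
  opdir K x v *m w = col4 0
  (- g * (a * q2 x + q1 x * b) * w 0 0 + 2 * g * q1 x * a * w 1 0)
  (- g * (a * p2 x + q1 x * d) * w 1 0 - g * (a * q2 x + q1 x * b) * w 3 0)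
  (g * (a * p2 x + q1 x * d) * w 0 0 + 2 * g * q1 x * a * w 3 0).
Proof.
(* Entrywise derivative of [K] in a direction with q_1, q_2, p_2 components [a], [b], [d]; p_1
   occurs in no entry. Kronecker deltas give the partial derivatives, and linearity the general
   direction. *)
pose D (a b d : C) : seq (seq C) :=
  [:: [:: 0; 0; 0; 0];
      [:: - g * (a * q2 x + q1 x * b); 2 * g * q1 x * a; 0; 0];
      [:: 0; - g * (a * p2 x + q1 x * d); 0;
          - g * (a * q2 x + q1 x * b)];
      [:: g * (a * p2 x + q1 x * d); 0; 0; 2 * g * q1 x * a]].
rewrite (@opdir_mx4 _ _ (fun k => D (k == 0)%:R (k == 1)%:R (k == 3)%:R)); last first.
  move=> k; apply: forall_ord4; apply: forall_ord4 => /=;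
  (apply: is_pderiv_eq; [is_pderiv_tac|rewrite /=; ring]).
rewrite sum_ord4 !(eqxx, ord4_eqE) (_ : _ + _ = mx4 (D a b d)).
  by apply/colP; apply: forall_ord4; rewrite mulmx4 !mxE /=; ring.
apply/matrixP; apply: forall_ord4; apply: forall_ord4;
by rewrite !mxE /= /a /b /d; ring.
Qed.

Lemma smooth_K_I2 : smooth_opfield K.
Proof.
apply: smooth_mx4; apply: forall_ord4; apply: forall_ord4 => /=;
by smooth_tac; exact: openT.
Qed.

Definition N_rows (x : pt) : seq (seq C) :=
  [:: [:: - (1 + g * q1 x ^+ 2); 0; 0; 0];
      [:: - g * q1 x * q2 x; 0; 0; 0];
      [:: 0; - g * q1 x * p2 x; - (1 + g * q1 x ^+ 2); - g * q1 x * q2 x];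
      [:: g * q1 x * p2 x; 0; 0; 0]].

(** Half the trace of [K x] is a = 1 + g q_1^2, so the diagonal (0, a, 0, a) becomes (-a, 0, -a, 0).
    The zero pattern required by [char_poly_mx4] is preserved. *)
Lemma N_I2E : N = fun x => mx4 (N_rows x).
Proof.
apply/funext => x; have trK : \tr (K x) = 2 * (1 + g * q1 x ^+ 2).
  by rewrite /mxtrace sum_ord4 !mxE /=; ring.
apply/matrixP; apply: forall_ord4; apply: forall_ord4;
by rewrite /N_I2 trK !mxE /=; field.
Qed.

Lemma smooth_N_I2 : smooth_opfield N.
Proof.
rewrite N_I2E.
apply: smooth_mx4; apply: forall_ord4; apply: forall_ord4 => /=;
by smooth_tac; exact: openT.
Qed.

Lemma N_I2_mul x a b c d : N x *m col4 a b c d = col4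
  (- (1 + g * q1 x ^+ 2) * a) (- g * q1 x * q2 x * a)
  (- g * q1 x * p2 x * b - (1 + g * q1 x ^+ 2) * c - g * q1 x * q2 x * d)
  (g * q1 x * p2 x * a).
Proof.
by rewrite N_I2E; apply/colP; apply: forall_ord4; rewrite mulmx4 !mxE /=; ring.
Qed.

Lemma opdir_N_I2 x (v w : 'cV[C]_4) (a := v 0 0) (b := v 1 0) (d := v 3 0) :
  opdir N x v *m w = col4
  (- (2 * g * q1 x * a * w 0 0))
  (- g * (a * q2 x + q1 x * b) * w 0 0)
  (- g * (a * p2 x + q1 x * d) * w 1 0 - 2 * g * q1 x * a * w 2 0
   - g * (a * q2 x + q1 x * b) * w 3 0)
  (g * (a * p2 x + q1 x * d) * w 0 0).
Proof.
pose D (a b d : C) : seq (seq C) :=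
  [:: [:: - (2 * g * q1 x * a); 0; 0; 0];
      [:: - g * (a * q2 x + q1 x * b); 0; 0; 0];
      [:: 0; - g * (a * p2 x + q1 x * d); - (2 * g * q1 x * a);
          - g * (a * q2 x + q1 x * b)];
      [:: g * (a * p2 x + q1 x * d); 0; 0; 0]].
rewrite N_I2E (@opdir_mx4 _ _ (fun k => D (k == 0)%:R (k == 1)%:R (k == 3)%:R)); last first.
  move=> k; apply: forall_ord4; apply: forall_ord4 => /=;
  (apply: is_pderiv_eq; [is_pderiv_tac|rewrite /=; ring]).
rewrite sum_ord4 !(eqxx, ord4_eqE) (_ : _ + _ = mx4 (D a b d)).
  by apply/colP; apply: forall_ord4; rewrite mulmx4 !mxE /=; ring.
apply/matrixP; apply: forall_ord4; apply: forall_ord4;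
by rewrite !mxE /= /a /b /d; ring.
Qed.

Lemma nijenhuis_N_I2 : nijenhuis_operator N.
Proof.
split; first exact: smooth_N_I2.
move=> X Y hX hY x; rewrite (nijenhuis_torsionE x smooth_N_I2 hX hY).
rewrite [X x]col4E [Y x]col4E /torsion_at !opdir_N_I2 !N_I2_mul !col4_coord.
rewrite !(col4N, col4D) !N_I2_mul !(col4N, col4D).
by apply/colP; apply: forall_ord4; rewrite mxE [RHS]mxE /=; ring.
Qed.

Lemma haantjes_K_I2 : haantjes_operator K.
Proof.
split; first exact: smooth_K_I2.
move=> X Y hX hY x; rewrite (haantjes_torsionE x smooth_K_I2 hX hY) /=.
rewrite [X x]col4E [Y x]col4E !K_I2_mul /torsion_at.
rewrite !(opdir_K_I2, K_I2_mul, col4_coord, col4N, col4D).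
by apply/colP; apply: forall_ord4; rewrite mxE [RHS]mxE /=; ring.
Qed.

End Operators.

(** * Eigenvalues, semisimplicity, compatibility with omega and the chain equation *)

Section Spectrum.
Variables (R : realType) (g : R[i]).
Local Notation C := R[i].
Local Notation pt := 'rV[R]_4.
Local Notation K := (K_I2 g).
Local Notation N := (N_I2 g).
Implicit Types x : pt.

Lemma char_poly_K_I2 x (a := 1 + g * q1 x ^+ 2) :
  char_poly (K x) = \prod_(z <- [:: 0; a; 0; a]) ('X - z%:P).
Proof. exact: char_poly_mx4. Qed.

Lemma char_poly_N_I2 x (a := - (1 + g * q1 x ^+ 2)) :
  char_poly (N x) = \prod_(z <- [:: a; 0; a; 0]) ('X - z%:P).
Proof. by rewrite N_I2E; exact: char_poly_mx4. Qed.

Lemma op_eigenvalueE (A : 'M[C]_4) z : op_eigenvalue A z = root (char_poly A) z.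
Proof.
have charT : char_poly A^T = char_poly A.
  rewrite /char_poly -det_tr; congr determinant; apply/matrixP => i j.
  by rewrite !mxE eq_sym.
by rewrite /op_eigenvalue eigenvalue_root_char charT.
Qed.

Lemma eigenvalue_K_I2 x z :
  op_eigenvalue (K x) z <-> (z = 0 \/ z = 1 + g * q1 x ^+ 2).
Proof.
rewrite op_eigenvalueE char_poly_K_I2 root_prod_XsubC !inE.
split; last by case=> ->; rewrite eqxx ?orbT.
by case/or4P => /eqP ->; [left|right|left|right].
Qed.

Lemma eigenvalue_N_I2 x z :
  op_eigenvalue (N x) z <-> (z = - (1 + g * q1 x ^+ 2) \/ z = 0).
Proof.
rewrite op_eigenvalueE char_poly_N_I2 root_prod_XsubC !inE.
split; last by case=> ->; rewrite eqxx ?orbT.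
by case/or4P => /eqP ->; [left|right|left|right].
Qed.

Definition two_rows (r s : 'cV[C]_4) : 'M[C]_(2, 4) :=
  \matrix_(i, j) (if i == 0 then r j 0 else s j 0).

Definition two_cols (r s : 'cV[C]_4) : 'M[C]_(4, 2) :=
  \matrix_(i, j) (if j == 0 then r i 0 else s i 0).

Lemma rank_le2 (A : 'M[C]_4) r s r' s' :
  A = two_cols r s *m two_rows r' s' -> (\rank A <= 2)%N.
Proof.
by move->; apply: leq_trans (mxrankM_maxl _ _) _; exact: rank_leq_col.
Qed.

(* The two ranks add up to at least 4 since K - (K - a) = a is invertible, and
   each is at most 2. *)
Lemma rank_K_I2 x (a := 1 + g * q1 x ^+ 2) : regular_domain g x ->
  \rank (K x) = 2%N /\ \rank (K x - a%:M) = 2%N.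
Proof.
rewrite /regular_domain /= -/a => a0.
have r1 : (\rank (K x) <= 2)%N.
  (* Rows 2 and 4 span the row space: row 1 is zero, and row 3 is their combination with
     coefficients - g q_1 p_2 / a and - g q_1 q_2 / a. *)
  apply: (@rank_le2 _
    (col4 0 1 (- g * q1 x * p2 x / a) 0) (col4 0 0 (- g * q1 x * q2 x / a) 1)
    (col4 (- g * q1 x * q2 x) a 0 0) (col4 (g * q1 x * p2 x) 0 0 a)).
  apply/matrixP; apply: forall_ord4; apply: forall_ord4;
  by rewrite [RHS]mxE sum_ord2 !mxE /= -/a; field.
have r2 : (\rank (K x - a%:M)%R <= 2)%N.
  (* Here rows 1 and 3 span, since rows 2 and 4 are multiples of row 1 = (-a, 0, 0, 0). *)
  apply: (@rank_le2 _
    (col4 1 (g * q1 x * q2 x / a) 0 (- g * q1 x * p2 x / a)) (col4 0 0 1 0)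
    (col4 (- a) 0 0 0) (col4 0 (- g * q1 x * p2 x) (- a) (- g * q1 x * q2 x))).
  apply/matrixP; apply: forall_ord4; apply: forall_ord4;
  by rewrite [RHS]mxE sum_ord2 !mxE /= -/a; field.
have r4 : (4 <= \rank (K x) + \rank (K x - a%:M)%R)%N.
  have r : \rank (K x - (K x - a%:M)) = 4%N.
    rewrite opprB addrC subrK; apply: mxrank_unit.
    by rewrite unitmxE det_scalar unitrX // unitfE.
  by rewrite -{1}r; apply: leq_trans (mxrank_add _ _) _; rewrite mxrank_opp.
split; apply/eqP; rewrite eqn_leq ?r1 ?r2 /=.
  by rewrite -(leq_add2r 2) (leq_trans r4) // leq_add2l.
by rewrite -(leq_add2l 2) (leq_trans r4) // leq_add2r.
Qed.

(** On the regular domain the roots 0 and a of the factored characteristic polynomial are distinct,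
    so each is counted exactly twice. Each eigenspace is a kernel of dimension 4 - 2 by
    [rank_K_I2]. *)
Lemma semisimple_K_I2 x : regular_domain g x ->
  [/\ alg_mult (K x) 0 = 2%N,
      alg_mult (K x) (1 + g * q1 x ^+ 2) = 2%N &
      semisimple (K x)].
Proof.
move=> xD; have [rk0 rka] := rank_K_I2 xD.
have a0 : 1 + g * q1 x ^+ 2 != 0 by exact: xD.
have m0 : alg_mult (K x) 0 = 2%N.
  by rewrite /alg_mult char_poly_K_I2 mu_prod_XsubC /= eqxx (negPf a0).
have ma : alg_mult (K x) (1 + g * q1 x ^+ 2) = 2%N.
  by rewrite /alg_mult char_poly_K_I2 mu_prod_XsubC /= eqxx eq_sym (negPf a0).
split => // z /eigenvalue_K_I2 [] ->; rewrite ?m0 ?ma /geom_mult /eigenspace;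
  rewrite mxrank_ker.
  by rewrite raddf0 subr0 mxrank_tr rk0.
by rewrite -(tr_scalar_mx 4) -raddfB mxrank_tr rka.
Qed.

Lemma omega_compatible_K_I2 : omega_compatible K.
Proof.
move=> x; rewrite (_ : Omega R = mx4 [:: [:: 0; 0; -1; 0]; [:: 0; 0; 0; -1];
                        [:: 1; 0; 0; 0]; [:: 0; 1; 0; 0]]); last first.
  apply/matrixP; apply: forall_ord4; apply: forall_ord4;
  by rewrite !mxE /omega sum_ord2 !qpixE !mxE ?eqxx ?ord4_eqE /=; ring.
apply/matrixP; apply: forall_ord4; apply: forall_ord4;
by rewrite !mulmx4 !mxE /=; ring.
Qed.

Lemma chain_K_I2 g1 x : (K x)^T *m dfun (H2 g1 g) x = dfun (I2 g1 g) x.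
Proof.
(* With the Kronecker delta [s], one formula covers all four partial derivatives. *)
pose s (k z : 'I_4) : C := (k == z)%:R.
have dH k : pderiv k (H2 g1 g) x =
    2 * p1 x * s k 2 + 2 * p2 x * s k 3
    + (g1 + 2 * g * (q1 x * p1 x + q2 x * p2 x)) *
      (s k 0 * p1 x + q1 x * s k 2 + s k 1 * p2 x + q2 x * s k 3).
  apply: is_pderiv_val; apply: is_pderiv_eq; first by rewrite /H2; is_pderiv_tac.
  by rewrite /s /=; ring.
have dI k : pderiv k (I2 g1 g) x =
    2 * g * (q1 x * s k 0 + q2 x * s k 1) * p2 x ^+ 2
    + (1 + g * (q1 x ^+ 2 + q2 x ^+ 2)) * 2 * p2 x * s k 3
    + g1 * (s k 1 * p2 x + q2 x * s k 3).
  apply: is_pderiv_val; apply: is_pderiv_eq; first by rewrite /I2; is_pderiv_tac.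
  by rewrite /s /=; ring.
apply/colP; apply: forall_ord4;
by rewrite mulmx4 !mxE !dH dI /s ?eqxx ?ord4_eqE /=; ring.
Qed.

End Spectrum.

(** * The extended point transformation and separation of variables *)

Section Transformation.
Variables (R : realType) (g : R[i]).
Hypothesis hg : real_or_imaginary g.
Local Notation C := R[i].
Local Notation pt := 'rV[R]_4.
Local Notation K := (K_I2 g).
Local Notation U := (regular_domain g).
Local Notation Phi := (QP g).
Implicit Types (x : pt) (i k : 'I_4).

Let a x : C := 1 + g * q1 x ^+ 2.
Let S x : C := sqrtc (a x).

Let S2 x : S x ^+ 2 = a x. Proof. exact: sqr_sqrtc. Qed.

Let S0 x : U x -> S x != 0. Proof. by move=> xU; rewrite sqrtc_eq0. Qed.

Lemma open_regular_domain : open U.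
Proof.
have sa : smooth_on setT a by rewrite /a; smooth_tac; exact: openT.
by apply: (@open_neq0 _ a) => x; exact: (Ck_continuous (sa 0%N)).
Qed.

(** The root depends on q_1 alone, so the one-variable result composes with the first coordinate. *)
Lemma differentiable_sqrtc_regular x : U x ->
  differentiable (repart S) x /\ differentiable (impart S) x.
Proof.
move=> xU; have [h1 h2] := derivable_sqrtc_line hg xU.
have dx : differentiable (fun y : pt => y 0 0) x by exact: differentiable_coord.
split; [move: h1|move: h2] => /derivable1_diffP h;
exact: (differentiable_comp dx h).
Qed.

Lemma smooth_sqrtc_regular : smooth_on U S.
Proof.
move=> k; apply: (@Ck_sqrt _ k U a S); [|exact: S2|by []| | |].
- exact: open_regular_domain.
- by move=> x /differentiable_sqrtc_regular[h1 h2]; split;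
    exact: differentiable_continuous.
- by move=> i x /differentiable_sqrtc_regular[h1 h2]; split;
    exact: diff_derivable.
- have sa : smooth_on U a by rewrite /a; smooth_tac; exact: open_regular_domain.
  exact: sa.
Qed.

(** Implicit differentiation of S^2 = a, followed by division by 2 S, which is nonzero on the
    regular domain. *)
Lemma is_pderiv_sqrtc_regular i x : U x ->
  is_pderiv i S x (g * q1 x * (i == 0)%:R / S x).
Proof.
move=> xU; have hS := smooth_is_pderiv i smooth_sqrtc_regular xU.
apply: (is_pderiv_eq hS).
have h2 := is_pderivX 2 hS.
have ha : is_pderiv i a x (2 * g * q1 x * (i == 0)%:R).
  apply: is_pderiv_eq; first by rewrite /a; is_pderiv_tac.
  by rewrite /=; ring.
have E : 2 * S x * pderiv i S x = 2 * g * q1 x * (i == 0)%:R.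
  rewrite -(is_pderiv_val ha) (_ : a = fun y => S y ^+ 2); last first.
    by apply/funext => y; rewrite S2.
  by rewrite (is_pderiv_val h2) /=; ring.
apply: (mulfI (mulf_neq0 (_ : 2 != 0) (S0 xU))); first by rewrite pnatr_eq0.
by rewrite E; have := S0 xU; move: (S x) => w w0; field.
Qed.

(** Powers of a are written as even powers of S, so that every denominator is a power of a single
    nonzero quantity. *)
Definition dQP x k : seq C :=
  let d := fun z : 'I_4 => (k == z)%:R in
  [:: d 0;
      d 1 / S x - g * q1 x * q2 x * d 0 / S x ^+ 3;
      d 2 + g * (d 0 * q2 x * p2 x + q1 x * d 1 * p2 x + q1 x * q2 x * d 3)
              / S x ^+ 2
          - 2 * g ^+ 2 * q1 x ^+ 2 * q2 x * p2 x * d 0 / S x ^+ 4;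
      d 3 * S x + g * q1 x * p2 x * d 0 / S x].

Lemma component_QP : (component Phi 0 = @Q1 R) * (component Phi 1 = Q2 g) *
  (component Phi 2 = P1 g) * (component Phi 3 = P2 g).
Proof. by do !split; apply/funext => x; rewrite /component mxE. Qed.

Lemma is_pderiv_QP i k x : U x ->
  is_pderiv k (component Phi i) x (nth 0 (dQP x k) i).
Proof.
move=> xU; have w0 := S0 xU; have hS := is_pderiv_sqrtc_regular k xU.
have w2 := S2 x; have a0 : 1 + g * q1 x ^+ 2 != 0 by exact: xU.
move: i; apply: forall_ord4; rewrite component_QP.
- exact: is_pderiv_coord.
- apply: is_pderiv_eq.
    by rewrite /Q2; is_pderiv_tac; exact: w0.
  by rewrite /= -/(a x) -/(S x); field.
- apply: is_pderiv_eq.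
    by rewrite /P1; is_pderiv_tac; exact: xU.
  by rewrite /= -/(a x) -w2; field.
- apply: is_pderiv_eq.
    by rewrite /P2; is_pderiv_tac.
  by rewrite /= -/(a x) -/(S x); field.
Qed.

Lemma smooth_QP i : smooth_on U (component Phi i).
Proof.
have oU := open_regular_domain; have hS := smooth_sqrtc_regular.
move: i; apply: forall_ord4; rewrite component_QP.
- exact: smooth_coord.
- by rewrite /Q2; smooth_tac => //; exact: S0.
- by rewrite /P1; smooth_tac.
- by rewrite /P2; smooth_tac.
Qed.

Lemma jacobian_QP x : U x -> Defs.jacobian Phi x = mx4
  [:: [:: 1; 0; 0; 0];
      [:: - g * q1 x * q2 x / S x ^+ 3; (S x)^-1; 0; 0];
      [:: g * q2 x * p2 x / S x ^+ 2
          - 2 * g ^+ 2 * q1 x ^+ 2 * q2 x * p2 x / S x ^+ 4;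
          g * q1 x * p2 x / S x ^+ 2; 1; g * q1 x * q2 x / S x ^+ 2];
      [:: g * q1 x * p2 x / S x; 0; 0; S x]].
Proof.
move=> xU; have w0 := S0 xU.
apply/matrixP => i k; rewrite !mxE (is_pderiv_val (is_pderiv_QP i k xU)).
by move: i k; apply: forall_ord4; apply: forall_ord4;
  rewrite /dQP /= ?(eqxx, ord4_eqE) /=; field.
Qed.

Lemma jacobian_QP_unit x : U x -> Defs.jacobian Phi x \in unitmx.
Proof.
move=> xU; have w0 := S0 xU; rewrite jacobian_QP //; set J := mx4 _.
(* A symplectic matrix with 2 x 2 blocks A, 0, C, D has the inverse with blocks D^T, 0, - C^T, A^T;
   this is that inverse for [J]. *)
pose J' : 'M[C]_4 := mx4
  [:: [:: 1; 0; 0; 0];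
      [:: g * q1 x * q2 x / S x ^+ 2; S x; 0; 0];
      [:: - (g * q2 x * p2 x / S x ^+ 2
          - 2 * g ^+ 2 * q1 x ^+ 2 * q2 x * p2 x / S x ^+ 4);
          - (g * q1 x * p2 x / S x); 1; - (g * q1 x * q2 x / S x ^+ 3)];
      [:: - (g * q1 x * p2 x / S x ^+ 2); 0; 0; (S x)^-1]].
suff /mulmx1_unit[] : J *m J' = 1%:M by [].
apply/matrixP; apply: forall_ord4; apply: forall_ord4;
by rewrite mulmx4 !mxE /=; field.
Qed.

Lemma jacobian_QP_K_I2 x : U x ->
  Defs.jacobian Phi x *m K x *m invmx (Defs.jacobian Phi x)
  = diag_mx (\row_i nth 0 [:: 0; a x; 0; a x] i).
Proof.
move=> xU; have w0 := S0 xU; have Ju := jacobian_QP_unit xU.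
suff -> : Defs.jacobian Phi x *m K x =
    diag_mx (\row_i nth 0 [:: 0; a x; 0; a x] i) *m Defs.jacobian Phi x.
  by rewrite mulmxK.
rewrite mul_diag_mx jacobian_QP //.
apply/matrixP; apply: forall_ord4; apply: forall_ord4;
by rewrite mulmx4 !mxE /= -/(a x) -?S2; field.
Qed.

Lemma omega_jacobian_QP x : U x -> forall X Y,
  omega (Defs.jacobian Phi x *m X) (Defs.jacobian Phi x *m Y) = omega X Y.
Proof.
move=> xU X Y; have w0 := S0 xU; rewrite jacobian_QP // /omega !sum_ord2 !qpixE.
by rewrite !mulmx4 !mxE /=; field.
Qed.

Lemma canonical_QP : canonical_trans U Phi.
Proof.
move=> x xU; have w0 := S0 xU.
have JE i k : pderiv k (component Phi i) x = Defs.jacobian Phi x i k by rewrite mxE.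
apply: forall_ord2; apply: forall_ord2; rewrite /poisson !sum_ord2 !qpixE !JE
  jacobian_QP //; split; rewrite !mxE /=; by field.
Qed.

(** The old coordinates are recovered in the order q_1, q_2, p_2, p_1: [Q1] determines S, which is
    cancelled from [Q2] and [P2], and the correction in [P1] involves only the first three. *)
Lemma QP_inj : {in U &, injective Phi}.
Proof.
move=> x y; rewrite !inE => xU yU e.
have E i : component Phi i x = component Phi i y by rewrite /component e.
have e1 : q1 x = q1 y by have := E 0; rewrite component_QP.
have eS : S x = S y by rewrite /S /a e1.
have w0 := S0 yU.
have e2 : q2 x = q2 y.
  have := E 1; rewrite component_QP /Q2 -/(a x) -/(a y) -/(S x) -/(S y) eS.
  by apply: mulIf; rewrite invr_neq0.
have e4 : p2 x = p2 y.
  have := E 3; rewrite component_QP /P2 -/(a x) -/(a y) -/(S x) -/(S y) eS.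
  exact: mulIf.
have e3 : p1 x = p1 y.
  by have := E 2; rewrite component_QP /P1 e1 e2 e4; exact: addIr.
by apply/rowP; apply: forall_ord4; [have := e1|have := e2|have := e3|have := e4] => - [].
Qed.

Lemma darboux_haantjes_QP : darboux_haantjes U K Phi.
Proof.
split; first exact: haantjes_K_I2.
- split; [exact: open_regular_domain|exact: smooth_QP|exact: QP_inj|].
  exact: jacobian_QP_unit.
- exact: omega_jacobian_QP.
- by move=> x xU; rewrite jacobian_QP_K_I2 // diag_mx_is_diag.
Qed.

Lemma extended_point_QP : extended_point_transformation U Phi.
Proof.
split; first exact: canonical_QP.
move=> x y _ _ e; have := e 0; have := e 1; rewrite !qpixE => e2 e1.
apply: forall_ord2; rewrite qpixE component_QP.
  by rewrite /Q1 /q1 e1.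
by rewrite /Q2 /q1 /q2 e1 e2.
Qed.

(** The root disappears because Q_2 P_2 = q_2 p_2 and P_2^2 = a p_2^2. *)
Lemma I2_QP g1 x : U x -> I2 g1 g x =
  P2 g x ^+ 2 + g1 * Q2 g x * P2 g x + g * (Q2 g x * P2 g x) ^+ 2.
Proof.
move=> xU; have w0 := S0 xU; have w2 := S2 x.
have e : Q2 g x * P2 g x = q2 x * p2 x.
  by rewrite /Q2 /P2 -/(a x) -/(S x); field.
by rewrite -mulrA e /P2 exprMn -/(a x) -/(S x) w2 /a /I2; ring.
Qed.

Lemma H2_QP g1 x : U x -> H2 g1 g x =
  P1 g x ^+ 2 + g1 * Q1 x * P1 g x + g * (Q1 x * P1 g x) ^+ 2
  + (P2 g x ^+ 2 + g1 * Q2 g x * P2 g x + g * (Q2 g x * P2 g x) ^+ 2)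
    / (1 + g * Q1 x ^+ 2).
Proof.
(* Folding the second block back into [I2] removes the root first; what remains is a rational
   identity with denominator a. *)
move=> xU; rewrite -I2_QP //; have : 1 + g * q1 x ^+ 2 != 0 by exact: xU.
by rewrite /H2 /I2 /P1 /Q1 => a0; field.
Qed.

Lemma separation_QP g1 : separation_variables U (H2 g1 g) (I2 g1 g) Phi.
Proof.
(* With f(Q, P) = P^2 + g1 Q P + g (Q P)^2, the separation relations are f(Q_1, P_1) + h2 / (1 + g
   Q_1^2) = h1 and f(Q_2, P_2) = h2. The second says I_2 = h2, which turns the first into H = h1. *)
exists (fun (k : 'I_2) Q P h1 h2 =>
  P ^+ 2 + g1 * Q * P + g * (Q * P) ^+ 2
  + (if k == 0 then h2 / (1 + g * Q ^+ 2) - h1 else - h2)).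
move=> x xU h1 h2; rewrite H2_QP // -I2_QP //.
split=> [[<- <-]|h].
  apply: forall_ord2; rewrite !qpixE !component_QP /=.
    by rewrite addrA subrr.
  by rewrite -I2_QP // subrr.
have := h 1; rewrite !qpixE !component_QP /= -I2_QP // => /subr0_eq e2.
have := h 0; rewrite !qpixE !component_QP /= addrA => /subr0_eq e1.
by rewrite -e1 -e2.
Qed.

End Transformation.

(** * The limit of the transformation as the parameter tends to 0 *)

Section IdentityLimit.
Variable R : realType.
Local Notation C := (R[i]^o).

Lemma sqrtc_Re_ge0 (z : R[i]) : 0 <= complex.Re (sqrtc z).
Proof. by case: z => u v; exact: sqrtr_ge0. Qed.

(* |sqrt z - 1| |sqrt z + 1| = |z - 1|, and the second factor is at least 1
   since the principal root has nonnegative real part. *)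
Lemma sqrtc_sub1_le (z : R[i]) : `|sqrtc z - 1| <= `|z - 1|.
Proof.
have -> : z - 1 = (sqrtc z - 1) * (sqrtc z + 1).
  by rewrite -{1}[z]sqr_sqrtc; ring.
rewrite normrM ler_peMr //; apply: le_trans (normc_ge_Re _).
have h := sqrtc_Re_ge0 z; rewrite raddfD /= lecR.
by rewrite ger0_norm ?addr_ge0 // lerDr.
Qed.

Lemma cvg_sqrtc1 : (sqrtc z : C) @[z --> (1 : C)] --> (1 : C).
Proof.
have FF : ProperFilter (nbhs (1 : C)) := nbhs_pfilter (1 : C).
apply/(@cvgrPdist_lt _ C _ (nbhs (1 : C))) => e e0; near=> z.
rewrite distrC (le_lt_trans (sqrtc_sub1_le z)) // distrC.
by near: z; apply/nbhs_ballP; exists e.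
Unshelve. all: by end_near. Qed.

Lemma QP_cvg_id (x : 'rV[R]_4) i :
  (QP g x 0 i : C) @[g --> within (@real_or_imaginary R) (nbhs (0 : C))]
    --> ((x 0 i)%:C : C).
Proof.
have cw : within (@real_or_imaginary R) (nbhs (0 : C)) --> nbhs (0 : C).
  exact: cvg_within.
(* The restricted filter is finer, so convergence along all complex [g] tending to 0 suffices. *)
apply: cvg_trans (cvg_app _ cw) _.
have cg : (g : C) @[g --> (0 : C)] --> (0 : C) by move=> A.
have FF : ProperFilter (nbhs (0 : C)) := nbhs_pfilter (0 : C).
have ca : (1 + g * q1 x ^+ 2 : C) @[g --> (0 : C)] --> (1 : C).
  rewrite -[X in _ --> X]addr0 -[X in _ + X](mul0r (q1 x ^+ 2)).
  apply: cvgD; first exact: cvg_cst.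
  exact: (cvgM cg (@cvg_cst _ _ _ _ _)).
have cs : (sqrtc (1 + g * q1 x ^+ 2) : C) @[g --> (0 : C)] --> (1 : C).
  exact: cvg_comp ca cvg_sqrtc1.
have n0 : (1 : C) != 0 by exact: oner_neq0.
have E j : (fun g => QP g x 0 j : C) =
    (fun g => nth 0 [:: Q1 x; Q2 g x; P1 g x; P2 g x] j).
  by apply/funext => g; rewrite mxE.
move: i; apply: forall_ord4; rewrite E /=.
- exact: cvg_cst.
- rewrite -[X in _ --> X]divr1; apply: cvgM; first exact: cvg_cst.
  exact: (cvgV n0 cs).
- rewrite -[X in _ --> X]addr0; apply: cvgD; first exact: cvg_cst.
  (* The limit 0 is given the shape of the correction term at g = 0, a = 1, so that limits combine
     factor by factor. *)
  rewrite -[X in _ --> X](_ : 0 * q1 x * q2 x * p2 x / 1 = 0); last by rewrite !mul0r.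
  apply: cvgM; last exact: (cvgV n0 ca).
  do 3!(apply: cvgM; last exact: cvg_cst).
  exact: cg.
- rewrite -[X in _ --> X]mulr1; apply: cvgM; first exact: cvg_cst.
  exact: cs.
Qed.

End IdentityLimit.

Theorem mainTheorem4 (R : realType) (g1 g2 : R[i])
    (hg1 : real_or_imaginary g1) (hg2 : real_or_imaginary g2) :
  (* 1 *)
  ([/\ haantjes_operator (K_I2 g2),
       omega_compatible (K_I2 g2) &
       forall x, (K_I2 g2 x)^T *m dfun (H2 g1 g2) x
                 = dfun (I2 g1 g2) x] /\
   (forall x a, op_eigenvalue (K_I2 g2 x) a <->
                (a = 0 \/ a = 1 + g2 * q1 x ^+ 2)) /\
   (forall x, regular_domain g2 x ->
      [/\ alg_mult (K_I2 g2 x) 0 = 2%N,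
          alg_mult (K_I2 g2 x) (1 + g2 * q1 x ^+ 2) = 2%N &
          semisimple (K_I2 g2 x)]) /\
   nijenhuis_operator (N_I2 g2) /\
   (forall x a, op_eigenvalue (N_I2 g2 x) a <->
                (a = - (1 + g2 * q1 x ^+ 2) \/ a = 0))) /\
  (* 2 *)
  ([/\ darboux_haantjes (regular_domain g2) (K_I2 g2) (QP g2),
       separation_variables (regular_domain g2) (H2 g1 g2) (I2 g1 g2) (QP g2),
       extended_point_transformation (regular_domain g2) (QP g2),
       canonical_trans (regular_domain g2) (QP g2) &
       forall x i,
         (QP g x 0 i : R[i]^o)
           @[g --> within (@real_or_imaginary R) (nbhs (0 : R[i]^o))]
         --> ((x 0 i)%:C : R[i]^o)]) /\
  (* 3 *)
  (forall x, regular_domain g2 x ->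
     I2 g1 g2 x = P2 g2 x ^+ 2 + g1 * Q2 g2 x * P2 g2 x
                  + g2 * (Q2 g2 x * P2 g2 x) ^+ 2 /\
     H2 g1 g2 x = P1 g2 x ^+ 2 + g1 * Q1 x * P1 g2 x
                  + g2 * (Q1 x * P1 g2 x) ^+ 2
                  + (P2 g2 x ^+ 2 + g1 * Q2 g2 x * P2 g2 x
                     + g2 * (Q2 g2 x * P2 g2 x) ^+ 2)
                    / (1 + g2 * Q1 x ^+ 2)).
Proof.
split; last split.
- split; [split|split; [|split; [|split]]].
  + exact: haantjes_K_I2.
  + exact: omega_compatible_K_I2.
  + exact: chain_K_I2.
  + exact: eigenvalue_K_I2.
  + exact: semisimple_K_I2.
  + exact: nijenhuis_N_I2.
  + exact: eigenvalue_N_I2.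
- split.
  + exact: darboux_haantjes_QP.
  + exact: separation_QP.
  + exact: extended_point_QP.
  + exact: canonical_QP.
  + exact: QP_cvg_id.
- by move=> x xU; split; [exact: I2_QP|exact: H2_QP].
Qed.
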